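(* Let $X,Y$ be finite, $\mu,\nu$ with full support, $c:X\times Y\to\mathbb{R}$, $\varepsilon>0$, and let $\varphi_1,\varphi_2$ be entropy functions each of which is non-negative, finite on $[0,\infty)$, and continuously differentiable on the interior of its domain. Let $\{X_i\}_{i\in I}$ be a basic partition of $X$, let $\mathcal{J}_A,\mathcal{J}_B$ be two composite partitions, and let $\pi_{\mathrm{init}}\in\mathcal{M}_+(X\times Y)$ be feasible, i.e. $E(\pi_{\mathrm{init}})<\infty$. Let $\mathrm{GetWeights}_0$ be an admissible weight function (in the sense defined in the context: continuous and strictly score-decreasing). Let $\mathrm{GetWeights}$ be another weight function performing at least as well as $\mathrm{GetWeights}_0$, i.e. such that for every plan $\pi\in\mathcal{M}_+(X\times Y)$, every composite partition $\mathcal{J}$, current cell plans $(\pi_J)_{J\in\mathcal{J}}$ with $\pi_J=\pi\llcorner(X_J\times Y)$, and new cell plans $(\tilde\pi_J)_{J\in\mathcal{J}}=(S_J(\pi))_{J\in\mathcal{J}}$, it holds $E(\bar\pi)\le E(\bar\pi_0)$, where $$\bar\pi=\sum_{J\in\mathcal{J}}(1-\theta_J)\pi_J+\theta_J\tilde\pi_J,\quad(\theta_J)_J=\mathrm{GetWeights}((\pi_J)_J,(\tilde\pi_J)_J),$$ $$\bar\pi_0=\sum_{J\in\mathcal{J}}(1-\theta^0_J)\pi_J+\theta^0_J\tilde\pi_J,\quad(\theta^0_J)_J=\mathrm{GetWeights}_0((\pi_J)_J,(\tilde\pi_J)_J).$$ Then the parallel unbalanced domain decomposition algorithm with weight function $\mathrm{GetWeights}$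 (defined in the context) is convergent: the sequence $(\pi^k)_k$ it generates from $\pi^0=\pi_{\mathrm{init}}$ converges to the globally optimal solution of $\inf_{\pi\in\mathcal{M}_+(X\times Y)}E(\pi)$.
   Context: $\mathcal{M}_+(Z)$ denotes the non-negative finite measures on $Z$. $\langle\phi,\rho\rangle$ is the integral of $\phi$ against $\rho$; $\pi\llcorner S$ is the restriction of $\pi$ to $S$. $\mathrm{P}_X,\mathrm{P}_Y$ are the marginal projections: $(\mathrm{P}_X\pi)(A)=\pi(A\times Y)$, $(\mathrm{P}_Y\pi)(B)=\pi(X\times B)$. $\mu\in\mathcal{M}_+(X)$, $\nu\in\mathcal{M}_+(Y)$. An entropy function is a lower semicontinuous convex function $\varphi:\mathbb{R}\to\mathbb{R}\cup\{\infty\}$ with $\mathrm{dom}(\varphi)\subseteq[0,\infty)$ and $\mathrm{dom}(\varphi)\setminus\{0\}\neq\emptyset$. Set $\varphi'_\infty=\lim_{x\to+\infty}\varphi(x)/x$. The associated divergence is $D_\varphi(\rho\mid\sigma)=\int_Z\varphi\left(\frac{\mathrm{d}\rho}{\mathrm{d}\sigma}\right)\mathrm{d}\sigma+\varphi'_\infty\,\rho^\perp(Z)$, where $\rho=\frac{\mathrm{d}\rho}{\mathrm{d}\sigma}\sigma+\rho^\perp$ is the Lebesgue decomposition. Write $D_1=D_{\varphi_1}$, $D_2=D_{\varphi_2}$. For $\rho\ll\sigma$, $\mathrm{KL}(\rho\mid\sigma)=\int\left[\frac{\mathrm{d}\rho}{\mathrm{d}\sigma}\log\frac{\mathrm{d}\rho}{\mathrm{d}\sigma}-\frac{\mathrm{d}\rho}{\mathrm{d}\sigma}+1\right]\mathrm{d}\sigma$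 (with $0\log 0=0$), and $+\infty$ otherwise. Global objective (score): $$E(\pi)=\langle c,\pi\rangle+\varepsilon\,\mathrm{KL}(\pi\mid\mu\otimes\nu)+D_1(\mathrm{P}_X\pi\mid\mu)+D_2(\mathrm{P}_Y\pi\mid\nu).$$ A basic partition $\{X_i\}_{i\in I}$ ($I$ finite) is a partition of $X$ into closed, $\mu$-essentially disjoint subsets with $\mu(X_i)>0$ for all $i$. A composite partition $\mathcal{J}$ is a partition of $I$; for $J\in\mathcal{J}$ the composite cell is $X_J=\bigcup_{i\in J}X_i$ and $\mu_J=\mu\llcorner X_J$. Cell objective, for $\nu_{-J}\in\mathcal{M}_+(Y)$ and $\pi_J\in\mathcal{M}_+(X_J\times Y)$: $$E_J(\pi_J\mid\nu_{-J})=\langle c,\pi_J\rangle+\varepsilon\,\mathrm{KL}(\pi_J\mid\mu_J\otimes\nu)+D_1(\mathrm{P}_X\pi_J\mid\mu_J)+D_2(\mathrm{P}_Y\pi_J+\nu_{-J}\mid\nu).$$ In this setting it has a unique minimizer over $\mathcal{M}_+(X_J\times Y)$. The cell solution map is $$S_J(\pi)=\operatorname*{argmin}_{\hat\pi_J\in\mathcal{M}_+(X_J\times Y)}E_J\left(\hat\pi_J\,\middle|\,\mathrm{P}_Y[\pi\llcorner((X\setminus X_J)\times Y)]\right).$$ A weight function $\mathrm{GetWeights}$ assigns, for each composite partition $\mathcal{J}$, to a pair of families $(\pi_J)_{J\in\mathcal{J}},(\tilde\pi_J)_{J\in\mathcal{J}}$ with $\pi_J,\tilde\pi_J\in\mathcal{M}_+(X_J\times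 Y)$ a vector $(\theta_J)_{J\in\mathcal{J}}\in[0,1]^{\mathcal{J}}$. A weight function $\mathrm{GetWeights}_0$ is called admissible here if (1) it is continuous, and (2) for every plan $\pi\in\mathcal{M}_+(X\times Y)$ and every composite partition $\mathcal{J}$, with $\pi_J=\pi\llcorner(X_J\times Y)$, $\tilde\pi_J=S_J(\pi)$ and $(\theta^0_J)_J=\mathrm{GetWeights}_0((\pi_J)_J,(\tilde\pi_J)_J)$, the plan $\bar\pi_0=\sum_{J\in\mathcal{J}}(1-\theta^0_J)\pi_J+\theta^0_J\tilde\pi_J$ satisfies $E(\bar\pi_0)<E(\pi)$ unless $\pi_J=\tilde\pi_J$ for all $J\in\mathcal{J}$. Parallel unbalanced domain decomposition algorithm with weight function $\mathrm{GetWeights}$: set $\pi^0=\pi_{\mathrm{init}}$. For $k=1,2,\dots$, let $\mathcal{J}=\mathcal{J}_A$ if $k$ is odd and $\mathcal{J}=\mathcal{J}_B$ if $k$ is even. For all $J\in\mathcal{J}$ set $\pi_J=\pi^{k-1}\llcorner(X_J\times Y)$ and $\tilde\pi_J=S_J(\pi^{k-1})$. Compute $(\theta_J)_J=\mathrm{GetWeights}((\pi_J)_J,(\tilde\pi_J)_J)$ and set $\pi^k=\sum_{J\in\mathcal{J}}(1-\theta_J)\pi_J+\theta_J\tilde\pi_J$. *)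

(* Defs.v *)
From HB Require Import structures.
From mathcomp Require Import all_boot all_order all_algebra.
From mathcomp Require Import all_classical all_reals all_analysis.
Import Order.TTheory GRing.Theory Num.Theory.
Import numFieldNormedType.Exports.

Set Implicit Arguments.
Unset Strict Implicit.
Unset Printing Implicit Defensive.

Local Open Scope classical_set_scope.
Local Open Scope ring_scope.
Local Open Scope ereal_scope.

(* Elements [x] of [A] at which [f] attains its minimum over [A]. *)
Definition argmin {R : realType} {T : Type} (A : set T) (f : T -> \bar R) :
    set T :=
  [set p | A p /\ forall q, A q -> f p <= f q].

(* A finite signed measure on a finite discrete space Z is identified with its
   mass function z |-> rho({z}). Weak-* convergence is then pointwise
   convergence, i.e. the topology of [{ptws Z -> R}]. *)
Notation meas R Z := {ptws Z -> R}.

Section FiniteMeasures.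
Context {R : realType}.

Section OneSpace.
Context {Z : finType}.
Implicit Types (rho sigma : meas R Z) (A : {set Z}).

(* M_+(A), seen inside the measures on Z: measures on A are extended by 0. *)
Definition Mplus A : set (meas R Z) :=
  [set rho | (forall z, 0 <= rho z)%R /\ (forall z, z \notin A -> rho z = 0%R)].

Definition full_support rho : Prop := forall z, (0 < rho z)%R.

Definition restr A rho : meas R Z := fun z => if z \in A then rho z else 0%R.

Definition mass_of rho A : R := (\sum_(z in A) rho z)%R.

Definition pairing (f : Z -> R) rho : R := (\sum_z f z * rho z)%R.

(* Since x / 0 = 0, the density is 0 outside the support of sigma. *)
Definition density rho sigma (z : Z) : R := (rho z / sigma z)%R.

Definition singular_part rho sigma : meas R Z :=
  fun z => if sigma z == 0%R then rho z else 0%R.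

Lemma lebesgue_decomposition rho sigma z :
  (rho z = density rho sigma z * sigma z + singular_part rho sigma z)%R.
Proof.
rewrite /density /singular_part; case: eqP => [->|/eqP s0].
  by rewrite mulr0 add0r.
by rewrite addr0 divfK.
Qed.

Definition abs_cont rho sigma : bool :=
  [forall z, (sigma z == 0%R) ==> (rho z == 0%R)].

(* [ln 0 = 0] in the library, so 0 log 0 = 0 as required. *)
Definition KL rho sigma : \bar R :=
  if abs_cont rho sigma then
    (\sum_z (density rho sigma z * ln (density rho sigma z)
             - density rho sigma z + 1) * sigma z)%R%:E
  else +oo.

End OneSpace.

Definition edom (phi : R -> \bar R) : set R := [set x | phi x < +oo].

Definition entropy_function (phi : R -> \bar R) : Prop :=
  [/\ forall x, phi x != -oo,
      lower_semicontinuous phi,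
      forall (x y t : R), (0 <= t <= 1)%R ->
        phi (t * x + (1 - t) * y)%R <= t%:E * phi x + (1 - t)%:E * phi y,
      edom phi `<=` [set x | (0 <= x)%R] &
      edom phi `\ 0%R !=set0].

Definition recession (phi : R -> \bar R) : \bar R :=
  lim ((phi x * (x^-1)%:E) @[x --> +oo%R]).

(* In [\bar R], 0 * oo = 0. *)
Definition divergence {Z : finType} (phi : R -> \bar R) (rho sigma : meas R Z) :
    \bar R :=
  \sum_z phi (density rho sigma z) * (sigma z)%:E
  + recession phi * (mass_of (singular_part rho sigma) [set: Z]%SET)%:E.

Definition C1_on_interior_dom (phi : R -> \bar R) : Prop :=
  forall x, (edom phi)° x ->
    derivable (fine \o phi) x 1%R /\
    {for x, continuous ((fine \o phi)^`()%classic : R -> R)}.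

Section Plans.
Context {X Y : finType}.

Definition PX (p : meas R (X * Y)%type) : meas R X :=
  fun x => (\sum_y p (x, y))%R.
Definition PY (p : meas R (X * Y)%type) : meas R Y :=
  fun y => (\sum_x p (x, y))%R.

Definition product_meas (mu : meas R X) (nu : meas R Y) :
    meas R (X * Y)%type :=
  fun z => (mu z.1 * nu z.2)%R.

Definition cylinder (A : {set X}) : {set X * Y} := [set z | z.1 \in A]%SET.

End Plans.
End FiniteMeasures.

Section DomainDecomposition.
Context {R : realType} {X Y I : finType}.
Local Notation plan := (meas R (X * Y)%type).

Variables (c : X * Y -> R) (eps : R) (mu : meas R X) (nu : meas R Y).
Variables (phi1 phi2 : R -> \bar R).

Definition score (p : plan) : \bar R :=
  (pairing c p)%:E + eps%:E * KL p (product_meas mu nu)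
  + divergence phi1 (PX p) mu + divergence phi2 (PY p) nu.

(* The cell objective E_J for X_J = A; plans on A * Y are extended by 0. *)
Definition cell_score (A : {set X}) (nu_rest : meas R Y) (p : plan) : \bar R :=
  (pairing c p)%:E + eps%:E * KL p (product_meas (restr A mu) nu)
  + divergence phi1 (PX p) (restr A mu)
  + divergence phi2 (fun y => PY p y + nu_rest y)%R nu.

(* Closedness of the cells is automatic, X being finite and discrete. *)
Definition basic_partition (Xc : I -> {set X}) : Prop :=
  [/\ (\bigcup_i Xc i)%SET = [set: X]%SET,
      forall i j, i != j -> mass_of mu (Xc i :&: Xc j)%SET = 0%R &
      forall i, (0 < mass_of mu (Xc i))%R].

Definition composite_partition (JJ : {set {set I}}) : bool :=
  finset.partition JJ [set: I]%SET.

Variable Xc : I -> {set X}.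

Definition cell (J : {set I}) : {set X} := (\bigcup_(i in J) Xc i)%SET.

(* S_J; the value 0 is only used if there is no minimizer. *)
Definition cell_solution (J : {set I}) (p : plan) : plan :=
  xget (fun=> 0%R)
    (argmin (Mplus (cylinder (cell J)))
       (cell_score (cell J) (PY (restr (cylinder (~: cell J)%SET) p)))).

Local Notation family JJ := {ptws {J : {set I} | J \in JJ} -> plan}.

Definition cell_family (JJ : {set {set I}}) : set (family JJ) :=
  [set f | forall J, Mplus (cylinder (cell (val J))) (f J)].

(* Only the values on pairs of families in [cell_family JJ], for [JJ] a
   composite partition, are meaningful. *)
Definition weights : Type :=
  forall JJ : {set {set I}},
    family JJ * family JJ -> {ptws {J : {set I} | J \in JJ} -> R}.

Definition weight_function (W : weights) : Prop :=
  forall JJ, composite_partition JJ ->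
  forall f g : family JJ, cell_family f -> cell_family g ->
  forall J, (0 <= W JJ (f, g) J <= 1)%R.

Definition current_plans (JJ : {set {set I}}) (p : plan) : family JJ :=
  fun J => restr (cylinder (cell (val J))) p.
Arguments current_plans : clear implicits.

Definition new_plans (JJ : {set {set I}}) (p : plan) : family JJ :=
  fun J => cell_solution (val J) p.
Arguments new_plans : clear implicits.

Definition update (W : weights) (JJ : {set {set I}}) (p : plan) : plan :=
  let theta := W JJ (current_plans JJ p, new_plans JJ p) in
  fun z => (\sum_J ((1 - theta J) * current_plans JJ p J z
                    + theta J * new_plans JJ p J z))%R.

Definition admissible (W : weights) : Prop :=
  (forall JJ, composite_partition JJ ->
     {within @cell_family JJ `*` @cell_family JJ, continuous (W JJ)}) /\
  (forall p JJ, Mplus [set: X * Y]%SET p -> composite_partition JJ ->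
     ~ (forall J, current_plans JJ p J = new_plans JJ p J) ->
     score (update W JJ p) < score p).

Fixpoint iterate (W : weights) (JA JB : {set {set I}}) (p0 : plan) (k : nat) :
    plan :=
  if k is k'.+1 then
    update W (if odd k then JA else JB) (iterate W JA JB p0 k')
  else p0.

End DomainDecomposition.

Arguments weights : clear implicits.

(* Main.v *)
Require Import Defs.
From HB Require Import structures.
From mathcomp Require Import all_boot all_order all_algebra.
From mathcomp Require Import all_classical all_reals all_analysis.
From mathcomp Require Import ring lra.
Import Order.TTheory GRing.Theory Num.Theory.
Import numFieldNormedType.Exports.

(** The score is a finite, continuous, strictly convex and coercive function of
    the plan: a sum of one scalar convex function per entry (cost plus entropy)
    and per point of either marginal. Sublevel sets are compact and there is
    exactly one minimizer [popt]. Three facts make the iteration converge to it.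

    - The cell problem on [J] minimizes the full score over the entries of the
      slab over the cell, the other entries being kept ([cell_score_energyE]).
      So [S_J] is a block minimizer; being unique and locally bounded, it
      depends continuously on the plan ([argmin_cvg], [block_min_cvg]). One
      step with the admissible weights is then a continuous map
      ([update_cvg]).

    - A plan that all cell problems leave unchanged is [popt]
      ([block_min_global], [block_fixpoint_optimal]). The infinite slope of the
      entropy at 0 makes such a plan positive everywhere, so that the score has
      partial derivatives there; each vanishes by optimality in some cell, and
      a critical point of a convex function is a minimizer. Differentiability
      of the entropy functions is essential: a kink in the second marginal
      penalty, which couples the cells, would allow other blockwise minimizers.

    - Hence a step with the admissible weights strictly decreases the score
      except at [popt], and the actual step decreases it at least as much. The
      iterates stay in a compact set; near a cluster point [q] other than
      [popt] the continuous admissible step would gain a fixed amount at every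
      visit, which contradicts the convergence of the scores ([descent_cvg]).
      The actual weights may be discontinuous, as they enter only through the
      score. *)

Set Implicit Arguments.
Unset Strict Implicit.
Unset Printing Implicit Defensive.

Local Open Scope classical_set_scope.
Local Open Scope ring_scope.

(** * Convergence by compactness *)

Lemma ptws_cvgP (U : eqType) (V : topologicalType)
    (F : set_system {ptws U -> V}) (f : {ptws U -> V}) : Filter F ->
  F --> f <-> forall z, g z @[g --> F] --> f z.
Proof.
move=> FF; split=> [Ff z|Ff].
  by apply: cvg_trans (@proj_continuous U (fun=> V) z f); exact: cvg_app Ff.
apply/cvg_sup => z; apply/cvg_image => [|W /= /Ff FW].
  rewrite eqEsubset; split => y //= _; exists (dfwith f z y) => //.
  by rewrite dfwithin.
exists ((fun g : {ptws U -> V} => g z) @^-1` W) => //.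
rewrite eqEsubset; split=> [_ [g Wg <-] //|y Wy].
by exists (dfwith f z y); rewrite /= dfwithin.
Qed.

Lemma ptws_fmap_cvgP (S : Type) (U : eqType) (V : topologicalType)
    (F : set_system S) (s : S -> {ptws U -> V}) (f : {ptws U -> V}) :
  Filter F ->
  s @ F --> f <-> forall z, s t z @[t --> F] --> f z.
Proof. by move=> FF; exact: ptws_cvgP. Qed.

(** If the filter missed a neighbourhood of [x], its trace on the complement
    would still cluster in the compact set, at a point other than [x]. *)
Lemma compact_unique_cluster_cvg (T : topologicalType) (F : set_system T)
    (V : set T) (x : T) : ProperFilter F -> compact V -> F V ->
  (forall q, V q -> cluster F q -> q = x) -> F --> x.
Proof.
move=> PF cV FV xP U nU; rewrite nbhs_simpl; apply: contrapT => nFU.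
have PG : ProperFilter (within (~` U) F).
  apply: Build_ProperFilter_ex => P FP; apply: contrapT => nP; apply: nFU.
  have : F [set y | (~` U) y -> P y] by exact: FP.
  apply: filterS => y UP; apply: contrapT => Uy.
  by apply: nP; exists y; exact: UP.
have FW A : F A -> within (~` U) F A by apply: filterS => y Ay _.
have [q [Vq qG]] := cV _ PG (FW _ FV).
have qx : q = x by apply: xP => // A B /FW; exact: qG.
have [y [Uy]] : ~` U `&` U !=set0.
  by rewrite qx in qG; apply: qG => //; exact: withinT.
by [].
Qed.

(** Minimizers depend continuously on a parameter as soon as they are unique
    and locally stay in a compact set: minimality passes to the cluster points
    of [s] at [p], which uniqueness identifies with [s p]. *)
Lemma argmin_cvg (R : realType) (P Q : topologicalType) (M : set P)
    (N V : set Q) (G : P -> Q -> R) (s : P -> Q) (p : P) :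
  M p -> compact V -> V `<=` N ->
  (forall q, N q -> G x.1 x.2
     @[x --> filter_prod (within M (nbhs p)) (within N (nbhs q))] --> G p q) ->
  (\forall p' \near within M (nbhs p), V (s p')) ->
  (forall p' r, M p' -> N r -> G p' (s p') <= G p' r) ->
  (forall q, N q -> (forall r, N r -> G p q <= G p r) -> q = s p) ->
  s @ within M (nbhs p) --> s p.
Proof.
move=> Mp cV VN Gcvg Vs smin suniq.
have PF : ProperFilter (within M (nbhs p)).
  by apply: Build_ProperFilter_ex => A /nbhs_singleton /(_ Mp); by exists p.
apply: (compact_unique_cluster_cvg _ cV) => // q Vq qs.
apply: suniq => [|r Nr]; first exact: VN.
rewrite leNgt; apply/negP => lt_rq.
pose m := (G p r + G p q) / 2.
have m1 : G p r < m by rewrite /m; lra.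
have m2 : m < G p q by rewrite /m; lra.
have := cvgr_lt _ (Gcvg r Nr) _ m1; case=> -[A1 B1] /= [nA1 nB1] AB1.
have := cvgr_gt _ (Gcvg q (VN _ Vq)) _ m2; case=> -[A2 B2] /= [nA2 nB2] AB2.
have B1r : B1 r by exact: (nbhs_singleton nB1).
have [y [[p' [A1p' A2p' Mp' Vp'] <-] B2y]] :
    (s @` [set p' | [/\ A1 p', A2 p', M p' & V (s p')]])
      `&` [set y | N y -> B2 y] !=set0.
  apply: qs => //; rewrite nbhs_simpl /=.
  near=> p'; exists p' => //; split.
  - by near: p'.
  - by near: p'.
  - by near: p'; exact: withinT.
  - by near: p'.
have := smin p' r Mp' Nr.
have /= := AB1 (p', r) (conj A1p' B1r).
have /= := AB2 (p', s p') (conj A2p' (B2y (VN _ Vp'))).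
lra.
Unshelve. all: by end_near. Qed.

(** At a cluster point [q] other than [x] both steps push [F] below some level
    [L < F q], and by continuity they do so uniformly near [q]. One visit near
    [q] then leaves [F] below [L] for ever, while every later visit near [q]
    has [F] above [L]. Hence [x] is the only cluster point. Comparing [u k.+1]
    with the step only through [F] is what allows an iteration that is itself
    discontinuous. *)
Lemma descent_cvg (R : realType) (T : topologicalType) (M V : set T)
    (F : T -> R) (step : bool -> T -> T) (b_ : nat -> bool) (u : nat -> T)
    (x : T) :
  compact V -> V `<=` M -> (forall k, V (u k)) ->
  (forall q, M q -> F @ within M (nbhs q) --> F q) ->
  (forall b q, M q -> M (step b q)) ->
  (forall b q, M q -> step b @ within M (nbhs q) --> step b q) ->
  (forall b q, M q -> q <> x -> F (step b q) < F q) ->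
  (forall k, F (u k.+1) <= F (u k)) ->
  (forall k, F (u k.+1) <= F (step (b_ k) (u k))) ->
  u @ \oo --> x.
Proof.
move=> cV VM Vu Fc stepM stepc stepF uF ustep.
have Fanti k n : (k <= n)%N -> F (u n) <= F (u k).
  elim: n => [|n IHn]; first by rewrite leqn0 => /eqP ->.
  rewrite leq_eqVlt => /predU1P[->//|kn].
  exact: le_trans (uF _) (IHn kn).
apply: (compact_unique_cluster_cvg _ cV) => [|q Vq qu].
  by exists 0%N => // k _; exact: Vu.
have Mq := VM _ Vq; apply: contrapT => qx.
pose m := Num.max (F (step true q)) (F (step false q)).
have mq : m < F q by rewrite /m gt_max !stepF.
pose L := (m + F q) / 2.
have mL : m < L by rewrite /L; lra.
have Lq : L < F q by rewrite /L; lra.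
have near_step b : \forall p \near within M (nbhs q), F (step b p) < L.
  have bL : F (step b q) < L.
    by apply: le_lt_trans mL; rewrite /m le_max; case: b; rewrite lexx ?orbT.
  have Fstep : F (step b p) @[p --> within M (nbhs q)] --> F (step b q).
    apply: (@cvg_comp _ _ _ (step b) F _ (within M (nbhs (step b q))));
      last exact/Fc/stepM.
    move=> A /= nA; near=> p.
    suff : M (step b p) -> A (step b p).
      by apply; apply: stepM; near: p; exact: withinT.
    near: p; exact: (stepc _ _ Mq _ nA).
  exact: cvgr_lt Fstep _ bL.
have near_L : \forall p \near within M (nbhs q), L < F p.
  exact: cvgr_gt (Fc q Mq) _ Lq.
pose W := [set p | M p -> (forall b, F (step b p) < L) /\ L < F p].
have nW : nbhs q W.
  suff : \forall p \near within M (nbhs q),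
    (forall b, F (step b p) < L) /\ L < F p by [].
  near=> p; split; last by near: p.
  by case; near: p; exact: near_step.
have often n : exists k, (n <= k)%N /\ W (u k).
  have [y [[k nk <-] Wy]] : (u @` [set k | (n <= k)%N]) `&` W !=set0.
    by apply: qu => //; exists n => // k /= nk; exists k.
  by exists k.
have [k [_ /(_ (VM _ (Vu k)))[stepL _]]] := often 0%N.
have uL : F (u k.+1) < L by exact: le_lt_trans (ustep k) (stepL _).
have [n [kn /(_ (VM _ (Vu n)))[_ Lu]]] := often k.+1.
by have := Fanti _ _ kn; lra.
Unshelve. all: by end_near. Qed.

(** * Convex functions on the half-line *)

Section ScalarConvexity.
Context {R : realType}.
Implicit Types (f : R -> R) (a b c e m t : R).

Definition convex_nneg f := forall a b t, 0 <= a -> 0 <= b -> 0 <= t <= 1 ->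
  f (t * a + (1 - t) * b) <= t * f a + (1 - t) * f b.

(** Differentiability is asked at positive points only: at 0 the one-sided
    slope may be infinite, as it is for the entropy. *)
Definition smooth_convex f := [/\ convex_nneg f,
  forall a, 0 <= a -> f @ within [set x | 0 <= x] (nbhs a) --> f a &
  forall a, 0 < a -> derivable f a 1].

Lemma convex_nneg_chord f a t : convex_nneg f -> 0 <= a -> 0 <= t <= 1 ->
  f (a + t) <= f a + t * (f (a + 1) - f a).
Proof.
move=> cf a0 t01; have a1 : 0 <= a + 1 by lra.
have := cf (a + 1) a t a1 a0 t01.
have -> : t * (a + 1) + (1 - t) * a = a + t by ring.
lra.
Qed.

Lemma convex_nneg_midpoint f a b : convex_nneg f -> 0 <= a -> 0 <= b ->
  f ((a + b) / 2) <= (f a + f b) / 2.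
Proof.
move=> cf a0 b0; have h01 : 0 <= (1 / 2 : R) <= 1 by apply/andP; split; lra.
have := cf a b _ a0 b0 h01.
have -> : 1 / 2 * a + (1 - 1 / 2) * b = (a + b) / 2 by lra.
lra.
Qed.

(** By convexity the difference quotients along the segment from [a] to [b]
    are at most [f b - f a]; they tend to the directional derivative. *)
Lemma convex_nneg_tangent f a b D : convex_nneg f -> 0 < a -> 0 <= b ->
  is_derive a 1 f D -> f a + D * (b - a) <= f b.
Proof.
move=> cf a0 b0 fD.
have [->|ba] := eqVneq b a; first by rewrite subrr mulr0 addr0.
pose g h := h * (b - a) + a.
pose q h := h^-1 * (f (g h) - f a).
have qD : q h @[h --> 0^'] --> D * (b - a).
  have gD : is_derive (0 : R) 1 g (b - a).
    by apply: is_derive_eq; rewrite /GRing.scale/=; ring.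
  have g0 : g 0 = a by rewrite /g mul0r add0r.
  have fD' : is_derive (g 0) 1 f D by rewrite g0.
  have [dc <-] := is_derive1_comp fD' gD.
  have -> : q = fun h : R =>
      h^-1 *: (((f \o g) \o shift 0) (h *: 1) - (f \o g) 0).
    by apply/funext => h; rewrite /q /= g0 /GRing.scale/= mulr1 addr0.
  exact: dc.
have : \forall h \near 0^'+, q h <= f b - f a.
  near=> h; have h0 : 0 < h by [].
  have h1 : h < 1 by near: h; exact: nbhs_right_lt.
  rewrite /q ler_pdivrMl//.
  have := cf b a h b0 (ltW a0); rewrite (ltW h0) (ltW h1) => /(_ isT).
  have -> : h * b + (1 - h) * a = g h by rewrite /g; ring.
  lra.
move=> /(cvgr_to_le (cvg_dnbhs_at_right qD)); lra.
Unshelve. all: by end_near. Qed.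

Lemma smooth_convex_cvg (T : Type) (F : set_system T) f (u : T -> R) a :
  Filter F -> smooth_convex f -> 0 <= a ->
  (\forall t \near F, 0 <= u t) -> u @ F --> a -> f (u t) @[t --> F] --> f a.
Proof.
move=> FF [_ fc _] a0 u0 ua.
apply: (@cvg_comp _ _ _ u f F (within [set x | 0 <= x] (nbhs a)));
  last exact: fc.
move=> A /= nA; near=> t.
suff : 0 <= u t -> A (u t) by apply; near: t.
near: t; exact: (ua _ nA).
Unshelve. all: by end_near. Qed.

Lemma smooth_convex_rescale f c e m : 0 <= e -> 0 < m -> smooth_convex f ->
  smooth_convex (fun t => c * t + e * (f (t / m) * m)).
Proof.
move=> e0 m0 [cf f0 df].
have dm a : 0 <= a -> 0 <= a / m by move=> a0; rewrite divr_ge0// ltW.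
split=> [a b t a0 b0 t01|a a0|a a0].
- have := cf _ _ t (dm _ a0) (dm _ b0) t01.
  have -> : t * (a / m) + (1 - t) * (b / m) = (t * a + (1 - t) * b) / m.
    by field; lra.
  move: (f _) (f _) (f _) => w v u uvw.
  have : e * m * u <= e * m * (t * v + (1 - t) * w).
    by apply: ler_wpM2l => //; rewrite mulr_ge0 // ltW.
  lra.
- apply: cvgD; first by apply: cvgM; [exact: cvg_cst|exact: cvg_within].
  apply: cvgM; first exact: cvg_cst.
  apply: cvgM; last exact: cvg_cst.
  have c1 : t / m @[t --> within [set x | 0 <= x] (nbhs a)] --> a / m.
    by apply: cvgM; [exact: cvg_within|exact: cvg_cst].
  apply: (@cvg_comp _ _ _ (fun t => t / m) f _
    (within [set x | 0 <= x] (nbhs (a / m)))).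
    move=> A /= nA; near=> t.
    suff : 0 <= t / m -> A (t / m) by apply; apply: dm; near: t; exact: withinT.
    near: t; exact: (c1 _ nA).
  exact/f0/dm.
- have am : 0 < a / m by rewrite divr_gt0.
  have gD : is_derive a 1 (fun t : R => t / m) m^-1.
    by apply: is_derive_eq; rewrite /GRing.scale/=; ring.
  have fD := DeriveDef (df _ am) erefl.
  have [h _] := @is_derive1_comp R f (fun t => t / m) a _ _ fD gD.
  apply: derivableD; first by [].
  by apply: derivableM.
Unshelve. all: by end_near. Qed.

(** Convexity alone gives upper semicontinuity at 0, by comparison with the
    chord over [0, 1]; only the lower bound has to be supplied. *)
Lemma convex_nneg_cvg0 f : convex_nneg f ->
  (forall e, 0 < e ->
    \forall t \near within [set x : R | 0 <= x] (nbhs (0 : R)),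
      f 0 - e < f t) ->
  f @ within [set x : R | 0 <= x] (nbhs (0:R)) --> f 0.
Proof.
move=> cf flsc; apply/cvgrPdist_lt => /= e e0.
pose d : R := `|f 1 - f 0| + 1.
have d0 : 0 < d by rewrite /d ltr_wpDl.
near=> t; have t0 : 0 <= t by near: t; exact: withinT.
have t1 : t < Num.min 1 (e / d).
  near: t; apply: cvg_within; apply: lt_nbhsl.
  by rewrite lt_min ltr01 /= divr_gt0.
have fte : f 0 - e < f t by near: t; exact: flsc.
move: t1; rewrite lt_min ltr_pdivlMr// => /andP[t1 td].
have := cf 1 0 t ler01 (lexx 0); rewrite t0 ltW//= => /(_ isT).
rewrite mulr1 mulr0 addr0 => ft.
have : t * (f 1 - f 0) <= t * d.
  by rewrite ler_wpM2l// /d (le_trans (ler_norm _))// lerDl.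
rewrite ltr_distlC; lra.
Unshelve. all: by end_near. Qed.

End ScalarConvexity.

(** * Entropy functions *)

Section Entropies.
Context {R : realType}.
Implicit Types (a b c e m t : R) (phi : R -> \bar R).

(** Continuity holds at positive points by differentiability, and at 0 by lower
    semicontinuity together with convexity. *)
Lemma smooth_convex_entropy phi : entropy_function phi ->
  (forall x : R, 0 <= x -> (phi x < +oo)%E) -> C1_on_interior_dom phi ->
  smooth_convex (fine \o phi).
Proof.
move=> [phiN philsc phic phidom _] phifin phiC1.
have fin x : 0 <= x -> phi x = (fine (phi x))%:E.
  by move=> x0; rewrite fineK// fin_numElt phifin// andbT ltNye phiN.
have dphi a : 0 < a -> derivable (fine \o phi) a 1.
  move=> a0; apply: (phiC1 _ _).1; rewrite /interior.
  have : \forall x \near a, 0 < x by exact: cvgr_gt cvg_id _ a0.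
  by apply: filterS => x /ltW; exact: phifin.
have cphi : convex_nneg (fine \o phi).
  move=> a b t a0 b0 t01; have := phic a b t t01.
  have /andP[t0 t1] := t01.
  have c0 : 0 <= t * a + (1 - t) * b by rewrite addr_ge0// mulr_ge0// subr_ge0.
  by rewrite (fin _ a0) (fin _ b0) (fin _ c0) -!EFinM -EFinD lee_fin.
split=> // a; rewrite le_eqVlt => /predU1P[<-|a0]; last first.
  apply: cvg_within_filter; apply: differentiable_continuous.
  exact/derivable1_diffP/dphi.
apply: (convex_nneg_cvg0 cphi) => e e0.
have : ((fine (phi 0%R) - e)%R%:E < phi 0%R)%E.
  by rewrite [ltRHS](fin _ (lexx 0)) lte_fin; lra.
move=> /philsc[V nV Vlt]; near=> t.
have t0 : 0 <= t by near: t; exact: withinT.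
rewrite -lte_fin/= -fin//; apply: Vlt; near: t; exact: cvg_within.
Unshelve. all: by end_near. Qed.

Definition kl_fun t : R := t * ln t - t + 1.

Lemma kl_fun0 : kl_fun 0 = 1.
Proof. by rewrite /kl_fun mul0r; lra. Qed.

(** This is [1 + s < expR s] at [s = - ln t]; the convexity properties of the
    entropy below are all derived from it. *)
Lemma kl_fun_gt0 t : 0 <= t -> t != 1 -> 0 < kl_fun t.
Proof.
rewrite le_eqVlt => /predU1P[<- _|t0 t1]; first by rewrite kl_fun0.
have tV0 : 0 < t^-1 by rewrite invr_gt0.
have lnN0 : ln t^-1 != 0 by rewrite ln_eq0// invr_eq1.
have := expR_gt1Dx lnN0; rewrite lnK ?posrE// lnV ?posrE// => ltV.
have -> : kl_fun t = t * (t^-1 - (1 - ln t)) by rewrite /kl_fun; field; lra.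
by rewrite mulr_gt0// subr_gt0.
Qed.

(** The gap to the tangent, the Bregman divergence of the entropy, is
    [a * kl_fun (b / a)]. *)
Lemma kl_fun_tangent_lt a b : 0 < a -> 0 <= b -> b != a ->
  kl_fun a + ln a * (b - a) < kl_fun b.
Proof.
move=> a0 b0 ba.
have : 0 < a * kl_fun (b / a).
  rewrite mulr_gt0// kl_fun_gt0 ?divr_ge0 ?(ltW a0)//.
  by apply: contra ba => /eqP ba1; rewrite -(divfK (lt0r_neq0 a0) b) ba1 mul1r.
suff -> : a * kl_fun (b / a) = kl_fun b - kl_fun a - ln a * (b - a) by lra.
move: b0; rewrite le_eqVlt => /predU1P[<-|b0].
  by rewrite mul0r kl_fun0 /kl_fun; ring.
rewrite /kl_fun ln_div ?posrE//; field; lra.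
Qed.

Lemma kl_fun_tangent a b : 0 < a -> 0 <= b ->
  kl_fun a + ln a * (b - a) <= kl_fun b.
Proof.
move=> a0 b0; have [->|ba] := eqVneq b a; first by rewrite subrr mulr0 addr0.
exact/ltW/kl_fun_tangent_lt.
Qed.

Lemma kl_fun_midpoint a b : 0 <= a -> 0 <= b -> a != b ->
  kl_fun ((a + b) / 2) < (kl_fun a + kl_fun b) / 2.
Proof.
move=> a0 b0 ab; have c0 : 0 < (a + b) / 2.
  by have [|] : a < b \/ b < a by [move: ab; rewrite neq_lt => /orP|]; lra.
have ca : a != (a + b) / 2 by apply: contra ab => /eqP h; apply/eqP; lra.
have cb : b != (a + b) / 2 by apply: contra ab => /eqP h; apply/eqP; lra.
have := kl_fun_tangent_lt c0 a0 ca; have := kl_fun_tangent_lt c0 b0 cb.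
have -> : b - (a + b) / 2 = - (a - (a + b) / 2) by lra.
rewrite mulrN; lra.
Qed.

Lemma smooth_convex_kl_fun : smooth_convex kl_fun.
Proof.
have ckl : convex_nneg kl_fun.
  (* The tangent at the barycentre lies below both values; if the barycentre
     is 0, the point that is not 0 has no weight. *)
  move=> a b t a0 b0 /andP[t0 t1].
  have s0 : 0 <= 1 - t by lra.
  have : 0 <= t * a + (1 - t) * b by rewrite addr_ge0 ?mulr_ge0.
  set s := _ + _; rewrite le_eqVlt => /predU1P[|c0].
    move/esym/eqP; rewrite /s paddr_eq0 ?mulr_ge0// !mulf_eq0.
    move=> /andP[ta sb]; rewrite -/s.
    have : t = 0 \/ t = 1 \/ (a = 0 /\ b = 0).
      case/orP: ta => /eqP ta; first by left.
      case/orP: sb => /eqP sb; first by right; left; lra.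
      by right; right.
    rewrite /s; case=> [->|[->|[-> ->]]];
      rewrite !(mulr0, subrr, subr0, mul0r, mul1r, add0r, addr0); lra.
  have ta : t * (kl_fun s + ln s * (a - s)) <= t * kl_fun a.
    by rewrite ler_wpM2l// kl_fun_tangent.
  have tb : (1 - t) * (kl_fun s + ln s * (b - s)) <= (1 - t) * kl_fun b.
    by rewrite ler_wpM2l// kl_fun_tangent.
  have e0 : t * (a - s) + (1 - t) * (b - s) = 0 by rewrite /s; ring.
  have : ln s * (t * (a - s) + (1 - t) * (b - s)) = 0 by rewrite e0 mulr0.
  lra.
have dkl a : 0 < a -> derivable kl_fun a 1.
  move=> a0; have [dln _] := is_derive1_ln a0.
  by apply: derivableD => //; apply: derivableB => //; exact: derivableM.
split=> // a; rewrite le_eqVlt => /predU1P[<-|a0]; last first.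
  apply: cvg_within_filter; apply: differentiable_continuous.
  exact/derivable1_diffP/dkl.
apply: (convex_nneg_cvg0 ckl) => e e0.
(* The tangent at e / 2 takes the value 1 - e / 2 at 0. *)
have e20 : 0 < e / 2 by lra.
pose d := `|ln (e / 2)| + 1.
have d0 : 0 < d by rewrite /d ltr_wpDl.
near=> t.
have t0 : 0 <= t by near: t; exact: withinT.
have : t < (e / 2) / d.
  by near: t; apply: cvg_within; apply: lt_nbhsl; rewrite divr_gt0.
rewrite ltr_pdivlMr// => td.
have := kl_fun_tangent e20 t0.
have : - (t * d) <= t * ln (e / 2).
  rewrite -mulrN ler_wpM2l// lerNl /d -normrN (le_trans (ler_norm _))// lerDl//.
rewrite kl_fun0 /kl_fun; lra.
Unshelve. all: by end_near. Qed.

End Entropies.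

Section EntropicCost.
Context {R : realType}.
Implicit Types c e m a b t C : R.

Definition entropic_cost c e m t : R := c * t + e * (kl_fun (t / m) * m).

Lemma smooth_convex_entropic_cost c e m : 0 < e -> 0 < m ->
  smooth_convex (entropic_cost c e m).
Proof.
move=> e0 m0.
by apply: smooth_convex_rescale => //; [exact: ltW|exact: smooth_convex_kl_fun].
Qed.

Lemma entropic_cost_midpoint c e m a b : 0 < e -> 0 < m ->
  0 <= a -> 0 <= b -> a != b ->
  entropic_cost c e m ((a + b) / 2) <
  (entropic_cost c e m a + entropic_cost c e m b) / 2.
Proof.
move=> e0 m0 a0 b0 ab.
have am0 : 0 <= a / m by rewrite divr_ge0// ltW.
have bm0 : 0 <= b / m by rewrite divr_ge0// ltW.
have abm : a / m != b / m.
  by apply: contra ab => /eqP /(mulIf (invr_neq0 (lt0r_neq0 m0))) ->.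
have em0 : 0 < e * m by rewrite mulr_gt0.
have := kl_fun_midpoint am0 bm0 abm; rewrite -(ltr_pM2l em0) /entropic_cost.
have -> : (a / m + b / m) / 2 = (a + b) / 2 / m by rewrite -mulrDl mulrAC.
lra.
Qed.

(** The entropy has slope [-oo] at 0, which beats any finite slope [C]. This
    forces minimizers to be positive. *)
Lemma entropic_cost_steep c e m C : 0 < e -> 0 < m ->
  exists2 t, 0 < t <= 1 &
    entropic_cost c e m t + C * t < entropic_cost c e m 0.
Proof.
move=> e0 m0.
(* The summand [m] makes [m * expR (- K) <= 1]; the other one puts the
   slope of the entropy between 0 and this point, [- (K + 1)], below
   [- (c + C) / e]. *)
pose K := `|(c + C) / e| + m.
have K0 : m <= K by rewrite /K lerDr.
exists (m * expR (- K)).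
  rewrite mulr_gt0 ?expR_gt0//= expRN ler_pdivrMr ?expR_gt0// mul1r.
  by apply: le_trans (expR_ge1Dx _); lra.
set s := expR (- K); have s0 : 0 < s by exact: expR_gt0.
rewrite /entropic_cost mul0r kl_fun0 /kl_fun.
have -> : m * s / m = s by field; exact: lt0r_neq0.
rewrite /s expRK -/s.
have : (c + C) / e < K + 1.
  by have := ler_norm ((c + C) / e); rewrite /K; lra.
rewrite ltr_pdivrMr// => cCe.
have : 0 < m * s * ((K + 1) * e - (c + C)) by rewrite !mulr_gt0// subr_gt0.
lra.
Qed.

(** The entropy grows faster than any linear function: its tangent at the
    point where [e * ln a = 1 - c] turns the total slope into 1. *)
Lemma entropic_cost_coercive c e m : 0 < e -> 0 < m ->
  exists C, forall t, 0 <= t -> t <= entropic_cost c e m t + C.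
Proof.
move=> e0 m0.
pose a := expR ((1 - c) / e); have a0 : 0 < a by exact: expR_gt0.
exists ((1 - c) * a * m) => t t0.
have tm0 : 0 <= t / m by rewrite divr_ge0// ltW.
have em0 : 0 <= e * m by rewrite mulr_ge0// ltW.
have := ler_wpM2l em0 (kl_fun_tangent a0 tm0).
have ka : 0 <= e * m * kl_fun a.
  have [a1|a1] := eqVneq a 1; last by rewrite mulr_ge0// ltW// kl_fun_gt0// ltW.
  by rewrite a1 /kl_fun ln1; lra.
rewrite {2}/a expRK /entropic_cost.
have -> : e * m * (kl_fun a + (1 - c) / e * (t / m - a)) =
    e * m * kl_fun a + (1 - c) * t - (1 - c) * a * m.
  by field; rewrite !lt0r_neq0.
lra.
Qed.

End EntropicCost.

(** * Energies on plans and their block minimizers *)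

Section Energy.
Context {R : realType} {X Y : finType}.
Local Notation plan := (meas R (X * Y)%type).
Local Notation nneg := (@Mplus R (X * Y)%type [set: X * Y]%SET).
Implicit Types (p q r : plan) (z : X * Y) (B : {set X * Y}).

Definition energy (h : X * Y -> R -> R) (g : X -> R -> R) (k : Y -> R -> R)
    p : R :=
  \sum_z h z (p z) + \sum_x g x (PX p x) + \sum_y k y (PY p y).

(** Isolates what the argument needs from the score: the terms of the plan are
    strictly convex, coercive and infinitely steep at 0, the terms of the
    marginals are only convex and nonnegative. *)
Record entropic_energy (h : X * Y -> R -> R) (g : X -> R -> R)
    (k : Y -> R -> R) : Prop := EntropicEnergy {
  plan_smooth_convex : forall z, smooth_convex (h z);
  PX_smooth_convex : forall x, smooth_convex (g x);
  PY_smooth_convex : forall y, smooth_convex (k y);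
  PX_cost_ge0 : forall x t, 0 <= t -> 0 <= g x t;
  PY_cost_ge0 : forall y t, 0 <= t -> 0 <= k y t;
  plan_midpoint : forall z (a b : R), 0 <= a -> 0 <= b -> a != b ->
    h z ((a + b) / 2) < (h z a + h z b) / 2;
  plan_steep : forall z (C : R),
    exists2 t : R, 0 < t <= 1 & h z t + C * t < h z 0;
  plan_coercive : forall z, exists C, forall t : R, 0 <= t -> t <= h z t + C }.

Definition overwrite B p q : plan := fun z => if z \in B then q z else p z.

Variables (h : X * Y -> R -> R) (g : X -> R -> R) (k : Y -> R -> R).
Hypothesis reg : entropic_energy h g k.
Let hC := plan_smooth_convex reg.
Let gC := PX_smooth_convex reg.
Let kC := PY_smooth_convex reg.
Local Notation E := (energy h g k).

Lemma Mplus_ge0 B p z : Mplus B p -> 0 <= p z.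
Proof. by case. Qed.

Lemma PX_ge0 p x : nneg p -> 0 <= PX p x.
Proof. by move=> [p0 _]; exact: sumr_ge0. Qed.

Lemma PY_ge0 p y : nneg p -> 0 <= PY p y.
Proof. by move=> [p0 _]; exact: sumr_ge0. Qed.

Lemma nnegE p : (forall z, 0 <= p z) -> nneg p.
Proof. by move=> p0; split=> // z; rewrite inE. Qed.

Lemma overwrite_nneg B p q : nneg p -> Mplus B q -> nneg (overwrite B p q).
Proof.
move=> [p0 _] [q0 _]; apply: nnegE => z; rewrite /overwrite.
by case: ifP.
Qed.

Lemma energy_cvg (T : Type) (F : set_system T) (s : T -> plan) p :
  Filter F -> nneg p -> (\forall t \near F, nneg (s t)) ->
  (forall z, s t z @[t --> F] --> p z) -> E (s t) @[t --> F] --> E p.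
Proof.
move=> FF p0 s0 sp.
have cX x : PX (s t) x @[t --> F] --> PX p x.
  by apply: cvg_big => //; exact: add_continuous.
have cY y : PY (s t) y @[t --> F] --> PY p y.
  by apply: cvg_big => //; exact: add_continuous.
apply: cvgD; first apply: cvgD.
- apply: cvg_big => [|z _]; first exact: add_continuous.
  apply: smooth_convex_cvg => //; first exact: Mplus_ge0 p0.
  by apply: filterS s0 => t; exact: Mplus_ge0.
- apply: cvg_big => [|x _]; first exact: add_continuous.
  apply: smooth_convex_cvg => //; first exact: PX_ge0.
  by apply: filterS s0 => t; exact: PX_ge0.
- apply: cvg_big => [|y _]; first exact: add_continuous.
  apply: smooth_convex_cvg => //; first exact: PY_ge0.
  by apply: filterS s0 => t; exact: PY_ge0.
Qed.

Lemma energy_coercive : exists C, forall p z, nneg p -> p z <= E p + C.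
Proof.
have /choice [C hCC] := (plan_coercive reg).
exists (\sum_z C z) => p z p0.
have pz : p z <= \sum_z p z.
  by rewrite (bigD1 z)//= lerDl sumr_ge0// => w _; exact: Mplus_ge0 p0.
apply: (le_trans pz).
have : \sum_z p z <= \sum_z (h z (p z) + C z).
  by apply: ler_sum => w _; apply: hCC; exact: Mplus_ge0 p0.
rewrite big_split /energy /=.
have : 0 <= \sum_x g x (PX p x).
  by apply: sumr_ge0 => x _; apply: (PX_cost_ge0 reg); exact: PX_ge0.
have : 0 <= \sum_y k y (PY p y).
  by apply: sumr_ge0 => y _; apply: (PY_cost_ge0 reg); exact: PY_ge0.
lra.
Qed.

Definition midpoint p q : plan := fun z => (p z + q z) / 2.

(** Strictness comes from the terms of the plan, as distinct plans may share
    their marginals. *)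
Lemma energy_midpoint p q : nneg p -> nneg q -> p <> q ->
  E (midpoint p q) < (E p + E q) / 2.
Proof.
move=> p0 q0 pq.
have [z pqz] : exists z, p z != q z.
  apply: contrapT => /forallNP npq; apply/pq/funext => z.
  exact/eqP/negPn/negP.
have mX x : PX (midpoint p q) x = (PX p x + PX q x) / 2.
  by rewrite /PX -big_split mulr_suml.
have mY y : PY (midpoint p q) y = (PY p y + PY q y) / 2.
  by rewrite /PY -big_split mulr_suml.
have hp w : 0 <= p w by exact: Mplus_ge0 p0.
have hq w : 0 <= q w by exact: Mplus_ge0 q0.
have h1 : \sum_z h z (midpoint p q z) < \sum_z (h z (p z) + h z (q z)) / 2.
  rewrite (bigD1 z)//= [ltRHS](bigD1 z)//=.
  apply: ltr_leD; first exact: (plan_midpoint reg).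
  by apply: ler_sum => w _; apply: convex_nneg_midpoint => //; have [] := hC w.
have h2 : \sum_x g x (PX (midpoint p q) x) <=
    \sum_x (g x (PX p x) + g x (PX q x)) / 2.
  apply: ler_sum => x _; rewrite mX.
  apply: convex_nneg_midpoint; try exact: PX_ge0.
  by have [] := gC x.
have h3 : \sum_y k y (PY (midpoint p q) y) <=
    \sum_y (k y (PY p y) + k y (PY q y)) / 2.
  apply: ler_sum => y _; rewrite mY.
  apply: convex_nneg_midpoint; try exact: PY_ge0.
  by have [] := kC y.
move: h1 h2 h3; rewrite -!mulr_suml !big_split /energy /=; lra.
Qed.

Definition is_block_min B p q := Mplus B q /\
  forall r, Mplus B r -> E (overwrite B p q) <= E (overwrite B p r).

Lemma block_min_unique B p q r : nneg p ->
  is_block_min B p q -> is_block_min B p r -> q = r.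
Proof.
move=> p0 [q0 qmin] [r0 rmin]; apply: contrapT => qr.
have gqr : overwrite B p q <> overwrite B p r.
  move=> e; apply: qr; apply/funext => z; move/(congr1 (fun f => f z)): e.
  rewrite /overwrite; case: ifPn => // zB _.
  by case: q0 => _ /(_ _ zB) ->; case: r0 => _ /(_ _ zB) ->.
have := energy_midpoint (overwrite_nneg p0 q0) (overwrite_nneg p0 r0) gqr.
have m0 : Mplus B (midpoint q r).
  split=> z; rewrite /midpoint.
    by rewrite divr_ge0// addr_ge0// (Mplus_ge0 _ q0, Mplus_ge0 _ r0).
  move=> zB; case: q0 => _ /(_ _ zB) ->; case: r0 => _ /(_ _ zB) ->.
  lra.
have -> : midpoint (overwrite B p q) (overwrite B p r) =
    overwrite B p (midpoint q r).
  apply/funext => z; rewrite /midpoint /overwrite; case: ifP => // _; lra.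
have := qmin _ m0; have := rmin _ m0; lra.
Qed.

(** A compact product of segments that consists of measures on [B]: the
    coordinates outside [B] are confined to 0. *)
Definition box B (b : R) : set plan :=
  [set q | forall z, `[0, (if z \in B then b else 0)]%classic (q z)].

Lemma compact_box B b : compact (box B b).
Proof.
apply: (@tychonoff _ (fun=> R)
  (fun z => `[0, (if z \in B then b else 0)]%classic)) => z.
exact: segment_compact.
Qed.

Lemma box_Mplus B b : box B b `<=` Mplus B.
Proof.
move=> q qB; split=> z.
  by have := qB z; rewrite /= in_itv /= => /andP[].
move=> zB; have := qB z; rewrite /= in_itv /= (negbTE zB) => qz.
by apply/eqP; rewrite eq_le andbC.
Qed.

Lemma Mplus_box B b q : Mplus B q -> (forall z, q z <= b) -> box B b q.
Proof.
move=> [q0 qB] qb z; rewrite /= in_itv /= q0 /=.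
by case: ifPn => // /qB ->.
Qed.

Lemma Mplus0 B : Mplus B (fun=> 0 : R).
Proof. by split. Qed.

Lemma block_energy_coercive : exists C, forall B p q z, nneg p -> Mplus B q ->
  q z <= E (overwrite B p q) + C.
Proof.
have [C pC] := energy_coercive; exists C => B p q z p0 q0.
have := pC _ z (overwrite_nneg p0 q0); rewrite {1}/overwrite.
case: ifPn => // zB; case: (q0) => _ /(_ _ zB) -> pz.
by apply: le_trans pz; exact: Mplus_ge0 p0.
Qed.

(** Outside a large box the energy exceeds that of the emptied block, so that
    minimizing over the box is enough. *)
Lemma block_min_exists B p : nneg p -> exists q, is_block_min B p q.
Proof.
move=> p0; have [C qC] := block_energy_coercive.
pose b := E (overwrite B p (fun=> 0)) + C.
have box0 : box B b (fun=> 0).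
  by apply: Mplus_box => [|z]; [exact: Mplus0|apply: qC => //; exact: Mplus0].
have [q] : exists2 q, q \in box B b &
    forall r, r \in box B b -> E (overwrite B p q) <= E (overwrite B p r).
  apply: (compact_EVT_min (f := fun q => E (overwrite B p q))) => //.
  - by exists (fun=> 0).
  - exact: compact_box.
  - apply/subspace_continuousP => q /box_Mplus q0.
    apply: energy_cvg; first exact: overwrite_nneg.
      near=> r; apply: overwrite_nneg => //; apply: (@box_Mplus B b).
      near: r; exact: withinT.
    move=> z; rewrite /overwrite; case: ifP => _; last exact: cvg_cst.
    apply: cvg_within_filter.
    exact: (@proj_continuous _ (fun=> R) z q).
rewrite inE => qb qmin; exists q; split; first exact: box_Mplus qb.
move=> r r0.
have [r_le|r_gt] := leP (E (overwrite B p r)) (E (overwrite B p (fun=> 0))).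
  apply: qmin; rewrite inE; apply: Mplus_box => // z.
  by apply: le_trans (qC _ _ _ _ p0 r0) _; rewrite lerD2r.
by apply: le_trans (ltW r_gt); apply: qmin; rewrite inE.
Unshelve. all: by end_near. Qed.

(** Coercivity confines the block minimizers for plans near [p] to one box:
    they do not exceed the energy obtained by emptying the block, which is
    continuous in the plan. *)
Lemma block_min_cvg B (s : plan -> plan) p :
  (forall q, nneg q -> is_block_min B q (s q)) -> nneg p ->
  s @ within nneg (nbhs p) --> s p.
Proof.
move=> smin p0; have [C qC] := block_energy_coercive.
pose b := E (overwrite B p (fun=> 0)) + 1 + C.
have proj_cvg q z : r z @[r --> nbhs q] --> q z.
  exact: (@proj_continuous _ (fun=> R) z q).
apply: (argmin_cvg (N := Mplus B) (V := box B b)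
  (G := fun q r => E (overwrite B q r))) => //.
- exact: compact_box.
- exact: box_Mplus.
- move=> q q0; apply: energy_cvg; first exact: overwrite_nneg.
    exists (nneg, Mplus B); first by split; exact: withinT.
    by move=> [r t] /= [r0 t0]; exact: overwrite_nneg.
  move=> z; rewrite /overwrite; case: ifP => _.
    apply: (@cvg_comp _ _ _ snd (fun r : plan => r z) _ _ _ cvg_snd).
    exact: cvg_within_filter.
  apply: (@cvg_comp _ _ _ fst (fun r : plan => r z) _ _ _ cvg_fst).
    exact: cvg_within_filter.
- have e1 : E (overwrite B p (fun=> 0)) < E (overwrite B p (fun=> 0)) + 1.
    by lra.
  have c0 : E (overwrite B q (fun=> 0)) @[q --> within nneg (nbhs p)] -->
      E (overwrite B p (fun=> 0)).
    apply: energy_cvg; first exact/overwrite_nneg/Mplus0.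
      near=> q; apply: overwrite_nneg; last exact: Mplus0.
      near: q; exact: withinT.
    move=> z; rewrite /overwrite; case: ifP => _; first exact: cvg_cst.
    exact: cvg_within_filter.
  near=> q; have q0 : nneg q by near: q; exact: withinT.
  have [sq0 sqmin] := smin _ q0.
  apply: Mplus_box => // z; apply: le_trans (qC _ _ _ _ q0 sq0) _.
  rewrite lerD2r; apply: le_trans (sqmin _ (Mplus0 B)) _; apply: ltW.
  near: q; exact: cvgr_lt c0 _ e1.
- by move=> q r q0 r0; exact: (smin _ q0).2.
- move=> q q0 qmin; apply: (block_min_unique p0 _ (smin _ p0)); by split.
Unshelve. all: by end_near. Qed.

Definition add_at z (t : R) p : plan :=
  fun w => p w + (if w == z then t else 0).

Lemma energy_add_at p x y t : E (add_at (x, y) t p) =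
  E p + (h (x, y) (p (x, y) + t) - h (x, y) (p (x, y)))
    + (g x (PX p x + t) - g x (PX p x)) + (k y (PY p y + t) - k y (PY p y)).
Proof.
have aX w : PX (add_at (x, y) t p) w = PX p w + (if w == x then t else 0).
  rewrite /PX big_split /=; congr (_ + _); case: eqVneq => [->|wx].
    rewrite (bigD1 y)//= eqxx big1 ?addr0// => v vy.
    by rewrite xpair_eqE (negbTE vy) andbF.
  by rewrite big1// => v _; rewrite xpair_eqE (negbTE wx).
have aY w : PY (add_at (x, y) t p) w = PY p w + (if w == y then t else 0).
  rewrite /PY big_split /=; congr (_ + _); case: eqVneq => [->|wy].
    rewrite (bigD1 x)//= eqxx big1 ?addr0// => v vx.
    by rewrite xpair_eqE (negbTE vx).
  by rewrite big1// => v _; rewrite xpair_eqE (negbTE wy) andbF.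
have sumE (I : finType) (f : I -> R -> R) (u v : I -> R) (i : I) :
    (forall j, v j = u j + (if j == i then t else 0)) ->
    \sum_j f j (v j) = \sum_j f j (u j) + (f i (u i + t) - f i (u i)).
  move=> vE; rewrite (bigD1 i)//= [in RHS](bigD1 i)//= vE eqxx.
  under eq_bigr => j ji do rewrite vE (negbTE ji) addr0.
  by ring.
rewrite /energy (sumE _ _ p _ (x, y))//.
rewrite (sumE _ _ (PX p) _ x)// (sumE _ _ (PY p) _ y)//.
by ring.
Qed.

(** Blockwise optimality implies global optimality because the energy is
    differentiable where it matters. At a blockwise minimizer every entry is
    positive, by the infinite slope of the entropy at 0, hence so are the
    marginals. Every partial derivative then exists and vanishes, each
    coordinate belonging to some block, and the tangent inequalities of all
    the terms add up to [E p <= E q]. *)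
Lemma block_min_global p : nneg p ->
  (forall z, exists2 B : {set X * Y}, z \in B & is_block_min B p (restr B p)) ->
  forall q, nneg q -> E p <= E q.
Proof.
move=> p0 pmin q q0.
have pmin1 z t : 0 <= p z + t -> E p <= E (add_at z t p).
  move=> zt; have [B zB [_ Bmin]] := pmin z.
  have := Bmin (restr B (add_at z t p)).
  have -> : overwrite B p (restr B p) = p.
    by apply/funext => w; rewrite /overwrite /restr; case: (w \in B).
  have -> : overwrite B p (restr B (add_at z t p)) = add_at z t p.
    apply/funext => w; rewrite /overwrite /restr /add_at.
    case: (boolP (w \in B)) => // wB.
    have -> : (w == z) = false by apply: contraNF wB => /eqP ->.
    by rewrite addr0.
  apply; split=> w; rewrite /restr; last by move=> /negbTE ->.
  case: ifP => // _; rewrite /add_at; case: eqP => [->//|_].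
  by rewrite addr0; exact: Mplus_ge0 p0.
(* The part of the energy that depends on the coordinate at [(x, y)]. *)
pose A x y t := h (x, y) (p (x, y) + t) + g x (PX p x + t) + k y (PY p y + t).
have Amin x y t : 0 <= p (x, y) + t -> A x y 0 <= A x y t.
  by move=> /pmin1; rewrite energy_add_at /A !addr0; lra.
have p_gt0 x y : 0 < p (x, y).
  rewrite lt0r (Mplus_ge0 _ p0) andbT; apply/negP => /eqP pz.
  pose Cg := g x (PX p x + 1) - g x (PX p x).
  pose Ck := k y (PY p y + 1) - k y (PY p y).
  have [t /andP[t0 t1]] := plan_steep reg (x, y) (Cg + Ck).
  have := Amin x y t; rewrite /A pz !add0r !addr0 => /(_ (ltW t0)).
  have t01 : 0 <= t <= 1 by rewrite ltW.
  have [cg _ _] := gC x; have := convex_nneg_chord cg (PX_ge0 x p0) t01.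
  have [ck _ _] := kC y; have := convex_nneg_chord ck (PY_ge0 y p0) t01.
  rewrite -/Cg -/Ck; lra.
have [[[x0 y0] _]|noXY] := pselect (exists z : X * Y, True); last first.
  suff -> : p = q by [].
  by apply/funext => z; case: noXY; exists z.
have PX_gt0 x : 0 < PX p x.
  rewrite /PX (bigD1 y0)//=; apply: ltr_wpDr => //.
  by apply: sumr_ge0 => y _; exact: Mplus_ge0 p0.
have PY_gt0 y : 0 < PY p y.
  rewrite /PY (bigD1 x0)//=; apply: ltr_wpDr => //.
  by apply: sumr_ge0 => x _; exact: Mplus_ge0 p0.
pose h' z : R := 'D_1 (h z) (p z).
pose g' x : R := 'D_1 (g x) (PX p x).
pose k' y : R := 'D_1 (k y) (PY p y).
have shift_derive (f : R -> R) (a t : R) : smooth_convex f -> 0 < a + t ->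
    is_derive t 1 (fun t => f (a + t)) ('D_1 f (a + t)).
  move=> [_ _ df] at0.
  have e1 : is_derive t 1 (fun t : R => a + t) 1.
    by apply: is_derive_eq; rewrite add0r mulr1.
  have e2 : is_derive (a + t) 1 f ('D_1 f (a + t)).
    by apply: DeriveDef => //; exact: df.
  by have := @is_derive1_comp R f (fun t => a + t) t _ _ e2 e1; rewrite mulr1.
have dA x y t : 0 < p (x, y) + t -> is_derive t 1 (A x y)
    ('D_1 (h (x, y)) (p (x, y) + t) + 'D_1 (g x) (PX p x + t)
     + 'D_1 (k y) (PY p y + t)).
  move=> zt.
  have xt : 0 < PX p x + t.
    rewrite /PX (bigD1 y)//= addrAC; apply: ltr_wpDr => //.
    by apply: sumr_ge0 => w _; exact: Mplus_ge0 p0.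
  have yt : 0 < PY p y + t.
    rewrite /PY (bigD1 x)//= addrAC; apply: ltr_wpDr => //.
    by apply: sumr_ge0 => w _; exact: Mplus_ge0 p0.
  apply: is_deriveD; [apply: is_deriveD|]; exact: shift_derive.
have grad0 x y : h' (x, y) + g' x + k' y = 0.
  have pz := p_gt0 x y.
  have A0 : is_derive (0 : R) 1 (A x y) 0.
    apply: (@derive1_at_min _ _ (- p (x, y)) (p (x, y))) => [|t|| t].
    - lra.
    - rewrite in_itv /= => /andP[t1 t2]; have zt : 0 < p (x, y) + t by lra.
      by have [] := dA _ _ _ zt.
    - by rewrite in_itv /=; apply/andP; split; lra.
    - by rewrite in_itv /= => /andP[t1 t2]; apply: Amin; lra.
  have z0 : 0 < p (x, y) + 0 by rewrite addr0.
  have [_ e1] := dA _ _ _ z0; have [_ e2] := A0.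
  by move: e1; rewrite e2 !addr0 => <-.
have tangent (f : R -> R) a b : smooth_convex f -> 0 < a -> 0 <= b ->
    f a + 'D_1 f a * (b - a) <= f b.
  move=> [cf _ df] a0 b0; apply: convex_nneg_tangent => //.
  by apply: DeriveDef => //; exact: df.
have h1 : \sum_z (h z (p z) + h' z * (q z - p z)) <= \sum_z h z (q z).
  by apply: ler_sum => -[x y] _; apply: tangent => //; exact: Mplus_ge0 q0.
have h2 : \sum_x (g x (PX p x) + g' x * (PX q x - PX p x)) <=
    \sum_x g x (PX q x).
  by apply: ler_sum => x _; apply: tangent => //; exact: PX_ge0.
have h3 : \sum_y (k y (PY p y) + k' y * (PY q y - PY p y)) <=
    \sum_y k y (PY q y).
  by apply: ler_sum => y _; apply: tangent => //; exact: PY_ge0.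
have e0 : \sum_z h' z * (q z - p z) + \sum_x g' x * (PX q x - PX p x)
    + \sum_y k' y * (PY q y - PY p y) = 0.
  have -> : \sum_x g' x * (PX q x - PX p x) = \sum_z g' z.1 * (q z - p z).
    under eq_bigr => x _ do rewrite /PX -sumrB mulr_sumr.
    by rewrite pair_bigA; apply: eq_bigr => -[].
  have -> : \sum_y k' y * (PY q y - PY p y) = \sum_z k' z.2 * (q z - p z).
    under eq_bigr => y _ do rewrite /PY -sumrB mulr_sumr.
    by rewrite exchange_big pair_bigA; apply: eq_bigr => -[].
  rewrite -!big_split big1// => -[x y] _ /=.
  by rewrite -!mulrDl grad0 mul0r.
move: h1 h2 h3; rewrite !big_split /= /energy; lra.
Qed.

End Energy.

(** * The scores as energies *)

Section FiniteScores.
Context {R : realType}.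

Definition marginal_cost (phi : R -> \bar R) (m t : R) : R :=
  fine (phi (t / m)) * m.

Lemma smooth_convex_marginal_cost (phi : R -> \bar R) m : 0 < m ->
  smooth_convex (fine \o phi) -> smooth_convex (marginal_cost phi m).
Proof.
move=> m0 /(smooth_convex_rescale 0 ler01 m0).
by under eq_fun do rewrite mul0r add0r mul1r.
Qed.

Section OneSpace.
Context {Z : finType}.
Implicit Types rho sigma : meas R Z.

Lemma KL_kl_fun rho sigma : (forall z, sigma z = 0 -> rho z = 0) ->
  KL rho sigma = (\sum_z kl_fun (rho z / sigma z) * sigma z)%:E.
Proof.
move=> ac; rewrite /KL; suff -> : abs_cont rho sigma by [].
by apply/forallP => z; apply/implyP => /eqP /ac ->.
Qed.

Lemma divergence_marginal_cost (phi : R -> \bar R) rho sigma :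
  (forall x, phi x != -oo%E) -> (forall x : R, 0 <= x -> (phi x < +oo)%E) ->
  (forall z, 0 <= rho z) -> (forall z, 0 <= sigma z) ->
  (forall z, sigma z = 0 -> rho z = 0) ->
  divergence phi rho sigma = (\sum_z marginal_cost phi (sigma z) (rho z))%:E.
Proof.
move=> phiN phifin rho0 sigma0 ac; rewrite /divergence.
have -> : mass_of (singular_part rho sigma) [set: Z]%SET = 0.
  rewrite /mass_of big1// => z _; rewrite /singular_part.
  by case: eqP => // /ac.
rewrite mule0 adde0 -sumEFin; apply: eq_bigr => z _.
rewrite /marginal_cost EFinM fineK// fin_numElt ltNye phiN phifin//.
by rewrite divr_ge0.
Qed.

End OneSpace.

Section Scores.
Context {X Y : finType}.
Local Notation plan := (meas R (X * Y)%type).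
Local Notation nneg := (@Mplus R (X * Y)%type [set: X * Y]%SET).
Variables (c : X * Y -> R) (eps : R) (mu : meas R X) (nu : meas R Y).
Variables (phi1 phi2 : R -> \bar R).
Hypotheses (hmu : full_support mu) (hnu : full_support nu) (heps : 0 < eps).
Hypotheses (phi1N : forall x, (phi1 x != -oo)%E)
  (phi2N : forall x, (phi2 x != -oo)%E).
Hypotheses (phi1_fin : forall x : R, 0 <= x -> (phi1 x < +oo)%E)
  (phi2_fin : forall x : R, 0 <= x -> (phi2 x < +oo)%E).

Definition plan_cost (z : X * Y) : R -> R :=
  entropic_cost (c z) eps (mu z.1 * nu z.2).

Definition score_energy : plan -> R :=
  energy plan_cost (fun x => marginal_cost phi1 (mu x))
    (fun y => marginal_cost phi2 (nu y)).

Lemma score_energyE (p : plan) : nneg p ->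
  score c eps mu nu phi1 phi2 p = (score_energy p)%:E.
Proof.
move=> p0; rewrite /score KL_kl_fun => [|z]; last first.
  move=> h; have := mulr_gt0 (hmu z.1) (hnu z.2).
  by rewrite -/(product_meas mu nu z) h ltxx.
rewrite !divergence_marginal_cost//; try by move=> *; exact: ltW.
- rewrite -EFinM -!EFinD /score_energy /energy /plan_cost /entropic_cost.
  by rewrite big_split/= -mulr_sumr.
- by move=> y; exact: PY_ge0.
- by move=> y e; have := hnu y; rewrite e ltxx.
- by move=> y; exact: PX_ge0.
- by move=> y e; have := hmu y; rewrite e ltxx.
Qed.

(** The cell score is the score of the completed plan up to a constant: the
    terms of the cost, of the entropy and of the first marginal split along
    the cell, and the second marginals of the two parts add up. *)
Lemma cell_score_energyE (A : {set X}) (p q : plan) :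
  nneg p -> Mplus (cylinder A) q ->
  cell_score c eps mu nu phi1 phi2 A (PY (restr (cylinder (~: A)%SET) p)) q =
  (score_energy (overwrite (cylinder A) p q)
   - (\sum_(z | z \notin cylinder A) plan_cost z (p z)
      + \sum_(x | x \notin A) marginal_cost phi1 (mu x) (PX p x)))%:E.
Proof.
move=> p0 [q0 qA].
have ov0 : nneg (overwrite (cylinder A) p q) by exact: overwrite_nneg.
have rmu0 x : 0 <= restr A mu x.
  by rewrite /restr; case: ifP => // _; exact: ltW.
have qx0 x : x \notin A -> forall y, q (x, y) = 0.
  by move=> xA y; apply: qA; rewrite inE.
have PXq x : PX q x = if x \in A then PX (overwrite (cylinder A) p q) x else 0.
  rewrite /PX /overwrite; case: ifPn => xA;
    last by rewrite big1// => y _; exact: qx0.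
  by apply: eq_bigr => y _; rewrite inE /= xA.
have PXp x : x \notin A -> PX (overwrite (cylinder A) p q) x = PX p x.
  by move=> xA; apply: eq_bigr => y _; rewrite /overwrite inE /= (negbTE xA).
have PYE : (fun y => PY q y + PY (restr (cylinder (~: A)%SET) p) y) =
    PY (overwrite (cylinder A) p q).
  apply/funext => y; rewrite /PY -big_split; apply: eq_bigr => x _ /=.
  rewrite /restr /overwrite !inE /=; case: (boolP (x \in A)) => xA /=.
    by rewrite addr0.
  by rewrite qx0// add0r.
have q_ac z : product_meas (restr A mu) nu z = 0 -> q z = 0.
  case: z => x y; rewrite /product_meas /restr /=.
  case: ifPn => xA; last by move=> _; exact: qx0.
  by move=> h; have := mulr_gt0 (hmu x) (hnu y); rewrite h ltxx.
rewrite /cell_score PYE KL_kl_fun//.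
rewrite (divergence_marginal_cost phi1N)//; last first.
- move=> x; rewrite /restr PXq; case: ifP => // _ e.
  by have := hmu x; rewrite e ltxx.
- by move=> x; exact: sumr_ge0.
rewrite (divergence_marginal_cost phi2N)//; last first.
- by move=> y e; have := hnu y; rewrite e ltxx.
- by move=> y; exact: ltW.
- by move=> y; exact: PY_ge0.
rewrite -EFinM -!EFinD /score_energy /energy; congr (_%:E).
have -> : \sum_x marginal_cost phi1 (restr A mu x) (PX q x) =
    \sum_(x in A) marginal_cost phi1 (mu x) (PX (overwrite (cylinder A) p q) x).
  rewrite [RHS]big_mkcond; apply: eq_bigr => x _.
  by rewrite PXq /restr /marginal_cost; case: ifP => //; rewrite mulr0.
have -> : pairing c q +
    eps * (\sum_z kl_fun (q z / product_meas (restr A mu) nu z)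
             * product_meas (restr A mu) nu z) =
    \sum_(z in cylinder A) plan_cost z (overwrite (cylinder A) p q z).
  rewrite [RHS]big_mkcond mulr_sumr -big_split; apply: eq_bigr => -[x y] _ /=.
  rewrite /plan_cost /entropic_cost /overwrite /product_meas /restr inE /=.
  by case: ifPn => // xA; rewrite qx0// !(mul0r, mulr0) addr0.
rewrite [in RHS](bigID (mem (cylinder A)))/= [\sum_x _ in RHS](bigID (mem A))/=.
have -> : \sum_(z | z \notin cylinder A)
      plan_cost z (overwrite (cylinder A) p q z) =
    \sum_(z | z \notin cylinder A) plan_cost z (p z).
  by apply: eq_bigr => z zA; rewrite /overwrite (negbTE zA).
have -> : \sum_(x | x \notin A)
      marginal_cost phi1 (mu x) (PX (overwrite (cylinder A) p q) x) =
    \sum_(x | x \notin A) marginal_cost phi1 (mu x) (PX p x).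
  by apply: eq_bigr => x xA; rewrite PXp.
by ring.
Qed.

End Scores.
End FiniteScores.

(** * The domain decomposition algorithm *)

Section DomainDecomposition.
Context {R : realType} {X Y I : finType}.
Local Notation plan := (meas R (X * Y)%type).
Local Notation nneg := (@Mplus R (X * Y)%type [set: X * Y]%SET).
Variables (c : X * Y -> R) (eps : R) (mu : meas R X) (nu : meas R Y).
Variables (phi1 phi2 : R -> \bar R) (Xc : I -> {set X}).
Hypotheses (hmu : full_support mu) (hnu : full_support nu) (heps : 0 < eps).
Hypotheses (hphi1 : entropy_function phi1) (hphi2 : entropy_function phi2).
Hypotheses (phi1_ge0 : forall x, (0 <= phi1 x)%E)
  (phi2_ge0 : forall x, (0 <= phi2 x)%E).
Hypotheses (phi1_fin : forall x : R, 0 <= x -> (phi1 x < +oo)%E)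
  (phi2_fin : forall x : R, 0 <= x -> (phi2 x < +oo)%E).
Hypotheses (phi1_C1 : C1_on_interior_dom phi1)
  (phi2_C1 : C1_on_interior_dom phi2).
Hypothesis hXc : basic_partition mu Xc.

Local Notation E := (score_energy c eps mu nu phi1 phi2).
Local Notation Score := (score c eps mu nu phi1 phi2).
Local Notation Update := (update c eps mu nu phi1 phi2 Xc).
Local Notation Solution := (cell_solution c eps mu nu phi1 phi2 Xc).
Local Notation slab J := (cylinder (Y := Y) (cell Xc J)).
Local Notation block_min := (is_block_min (plan_cost c eps mu nu)
  (fun x => marginal_cost phi1 (mu x)) (fun y => marginal_cost phi2 (nu y))).

Lemma score_entropic_energy : entropic_energy (plan_cost c eps mu nu)
  (fun x => marginal_cost phi1 (mu x)) (fun y => marginal_cost phi2 (nu y)).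
Proof.
have munu z : 0 < mu z.1 * nu z.2 by rewrite mulr_gt0.
split=> [z|x|y|x t t0|y t t0|z a b a0 b0 ab|z C|z].
- exact: smooth_convex_entropic_cost.
- by apply: smooth_convex_marginal_cost => //; exact: smooth_convex_entropy.
- by apply: smooth_convex_marginal_cost => //; exact: smooth_convex_entropy.
- by rewrite mulr_ge0 ?fine_ge0// ltW.
- by rewrite mulr_ge0 ?fine_ge0// ltW.
- exact: entropic_cost_midpoint.
- exact: entropic_cost_steep.
- exact: entropic_cost_coercive.
Qed.
Let reg := score_entropic_energy.

Let phi1N : forall x, phi1 x != -oo%E. Proof. by case: hphi1. Qed.
Let phi2N : forall x, phi2 x != -oo%E. Proof. by case: hphi2. Qed.

Let scoreE p : nneg p -> Score p = (E p)%:E.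
Proof. exact: score_energyE. Qed.

Lemma cell_solution_block_min J p : nneg p ->
  block_min (slab J) p (Solution J p).
Proof.
move=> p0; have [q [q0 qmin]] := block_min_exists reg (slab J) p0.
have : argmin (Mplus (slab J)) (cell_score c eps mu nu phi1 phi2 (cell Xc J)
    (PY (restr (cylinder (~: cell Xc J)%SET) p))) (Solution J p).
  apply: (xgetPex (fun=> 0)); exists q; split=> // r r0.
  by rewrite !cell_score_energyE// lee_fin lerD2r qmin.
case=> s0 smin; split=> // r r0.
by have := smin _ r0; rewrite !cell_score_energyE// lee_fin lerD2r.
Qed.

Lemma restr_Mplus (B : {set X * Y}) p : nneg p -> Mplus B (restr B p).
Proof.
move=> p0; split=> z; rewrite /restr; last by move=> /negbTE ->.
by case: ifP => // _; exact: Mplus_ge0 p0.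
Qed.

Section Step.
Variables (JJ : {set {set I}}) (hJJ : composite_partition JJ).
Implicit Types (J : {J : {set I} | J \in JJ}) (p : plan).
Local Notation Current := (current_plans (JJ := JJ) Xc).
Local Notation New := (new_plans (JJ := JJ) c eps mu nu phi1 phi2 Xc).

Lemma cell_family_current p : nneg p -> cell_family Xc (Current p).
Proof. by move=> p0 J; exact: restr_Mplus. Qed.

Lemma cell_family_new p : nneg p -> cell_family Xc (New p).
Proof. by move=> p0 J; exact: (cell_solution_block_min _ p0).1. Qed.

Lemma cell_cover x : exists J, x \in cell Xc (val J).
Proof.
have [covX _ _] := hXc.
have /finset.bigcupP [i _ xi] : x \in (\bigcup_i Xc i)%SET.
  by rewrite covX inE.
have [/eqP covI _ _] := and3P hJJ.
have /finset.bigcupP [J JJJ iJ] : i \in finset.cover JJ by rewrite covI inE.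
by exists (Sub J JJJ); apply/finset.bigcupP; exists i.
Qed.

(** As [mu] charges every point, essentially disjoint cells are disjoint. *)
Lemma cell_disjoint x J J' :
  x \in cell Xc (val J) -> x \in cell Xc (val J') -> J = J'.
Proof.
move=> /finset.bigcupP [i iJ xi] /finset.bigcupP [i' i'J' xi'].
have [_ disjX _] := hXc.
have ii' : i = i'.
  apply/eqP; apply: contraT => /disjX.
  rewrite /mass_of (bigD1 x)/=; last by rewrite inE xi.
  have : 0 <= \sum_(j in (Xc i :&: Xc i')%SET | j != x) mu j.
    by apply: sumr_ge0 => j _; exact: ltW.
  by have := hmu x; lra.
have [_ tI _] := and3P hJJ; apply/val_inj.
rewrite -(def_pblock tI (valP J) iJ) -(def_pblock tI (valP J') i'J').
by rewrite ii'.
Qed.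

Lemma block_fixpoint_optimal p : nneg p ->
  (forall J, Current p J = New p J) ->
  forall q, nneg q -> E p <= E q.
Proof.
move=> p0 pfix; apply: (block_min_global reg) => // z.
have [J zJ] := cell_cover z.1; exists (slab (val J)); first by rewrite inE.
have := pfix J; rewrite /current_plans /new_plans => ->.
exact: cell_solution_block_min.
Qed.

Lemma update_nneg V p : weight_function Xc V -> nneg p -> nneg (Update V JJ p).
Proof.
move=> wV p0; apply: nnegE => z; apply: sumr_ge0 => J _.
have /andP[t0 t1] :=
  wV JJ hJJ _ _ (cell_family_current p0) (cell_family_new p0) J.
have c0 := cell_family_current p0 J; have n0 := cell_family_new p0 J.
by rewrite addr_ge0// mulr_ge0// ?subr_ge0// (Mplus_ge0 _ c0, Mplus_ge0 _ n0).
Qed.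

(** The restrictions of a plan to the cells reassemble it, whatever the
    weights. *)
Lemma update_fixpoint V p :
  (forall J, Current p J = New p J) -> Update V JJ p = p.
Proof.
move=> pfix; apply/funext => z; rewrite /update.
under eq_bigr => J _ do rewrite -pfix -mulrDl subrK mul1r.
have [J0 zJ0] := cell_cover z.1.
rewrite (bigD1 J0)//= big1 => [|J JJ0]; rewrite /current_plans /restr inE /=.
  by rewrite zJ0 addr0.
case: ifPn => // zJ; by rewrite (cell_disjoint zJ zJ0) eqxx in JJ0.
Qed.

(** The only place where continuity of the weights is used; it is relative to
    the pairs of families of cell plans, where the update takes them. *)
Lemma update_cvg V p : admissible c eps mu nu phi1 phi2 Xc V -> nneg p ->
  Update V JJ @ within nneg (nbhs p) --> Update V JJ p.
Proof.
move=> [Vc _] p0.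
have cc J : Current q J @[q --> within nneg (nbhs p)] --> Current p J.
  apply/ptws_fmap_cvgP => z; rewrite /current_plans /restr.
  case: ifP => _; last exact: cvg_cst.
  apply: cvg_within_filter; exact: (@proj_continuous _ (fun=> R) z p).
have cn J : New q J @[q --> within nneg (nbhs p)] --> New p J.
  apply: (block_min_cvg reg (B := slab (val J)) (s := Solution (val J))) => //.
  move=> q q0.
  exact: cell_solution_block_min.
pose family := {ptws {J : {set I} | J \in JJ} -> plan}.
have cC : (Current : plan -> family) @ within nneg (nbhs p)
    --> (Current p : family).
  exact: (ptws_fmap_cvgP _ _ _).2 cc.
have cN : (New : plan -> family) @ within nneg (nbhs p)
    --> (New p : family).
  exact: (ptws_fmap_cvgP _ _ _).2 cn.
have ct J : V JJ (Current q, New q) J @[q --> within nneg (nbhs p)]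
    --> V JJ (Current p, New p) J.
  move: J; apply/ptws_fmap_cvgP.
  pose D := @cell_family R X Y I Xc JJ `*` @cell_family R X Y I Xc JJ.
  apply: (@cvg_comp _ _ _ (fun q => (Current q, New q)) (V JJ) _
    (within D (nbhs (Current p, New p)))).
    move=> A /= nA; near=> q.
    suff : D (Current q, New q) -> A (Current q, New q).
      apply; have q0 : nneg q by near: q; exact: withinT.
      by split; [exact: cell_family_current|exact: cell_family_new].
    near: q.
    have : (Current q, New q) @[q --> within nneg (nbhs p)] -->
        (Current p, New p).
      exact: cvg_pair cC cN.
    by move=> /(_ _ nA).
  have /subspace_continuousP := Vc JJ hJJ; apply.
  by split; [exact: cell_family_current|exact: cell_family_new].
apply/ptws_fmap_cvgP => z.
apply: cvg_big => [|J _]; first exact: add_continuous.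
have ccz := (ptws_fmap_cvgP _ _ _).1 (cc J) z.
have cnz := (ptws_fmap_cvgP _ _ _).1 (cn J) z.
apply: cvgD; last by apply: cvgM; [exact: ct|exact: cnz].
by apply: cvgM; [apply: cvgB; [exact: cvg_cst|exact: ct]|exact: ccz].
Unshelve. all: by end_near. Qed.

End Step.

Lemma update_score_le V JJ p : composite_partition JJ ->
  admissible c eps mu nu phi1 phi2 Xc V -> nneg p ->
  (Score (Update V JJ p) <= Score p)%E.
Proof.
move=> hJJ [_ Vdec] p0.
have [pfix|/(Vdec p JJ p0 hJJ)/ltW //] := pselect (forall J,
  current_plans Xc p J = new_plans (JJ := JJ) c eps mu nu phi1 phi2 Xc p J).
by rewrite update_fixpoint.
Qed.

(** Global minimization is block minimization over the block of all
    coordinates. *)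
Lemma score_minimizer : exists2 popt, nneg popt &
  forall p, nneg p -> E popt <= E p /\ (E p <= E popt -> p = popt).
Proof.
have zero0 : nneg (fun=> 0) by exact: Mplus0.
have fullE (p q : plan) : overwrite [set: X * Y]%SET p q = q.
  by apply/funext => z; rewrite /overwrite inE.
have [popt pmin] := block_min_exists reg [set: X * Y]%SET zero0.
have [p0 pE] := pmin; exists popt => // p p_ge0.
split=> [|pp]; first by have := pE _ p_ge0; rewrite !fullE.
apply: (block_min_unique reg zero0 _ pmin); split=> // q q0.
by have := pE _ q0; rewrite !fullE; exact: le_trans.
Qed.

Lemma iterate_cvg_minimizer (JA JB : {set {set I}}) (pinit : plan)
    (W0 W : weights R X Y I) :
  composite_partition JA -> composite_partition JB -> nneg pinit ->
  weight_function Xc W0 -> admissible c eps mu nu phi1 phi2 Xc W0 ->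
  weight_function Xc W ->
  (forall p JJ, nneg p -> composite_partition JJ ->
    (Score (Update W JJ p) <= Score (Update W0 JJ p))%E) ->
  exists2 popt : plan, argmin nneg Score = [set popt] &
    iterate c eps mu nu phi1 phi2 Xc W JA JB pinit @ \oo --> popt.
Proof.
move=> hJA hJB hpinit hW0 W0_admissible hW W_le_W0.
have [popt popt0 popt_min] := score_minimizer.
exists popt.
  apply/seteqP; split=> [p [p0 pmin]|_ ->].
    apply: (popt_min p p0).2.
    by have := pmin _ popt0; rewrite !scoreE// lee_fin.
  split=> // q q0; rewrite !scoreE// lee_fin; exact: (popt_min q q0).1.
pose JJ (b : bool) := if b then JA else JB.
have hJJ b : composite_partition (JJ b) by case: b.
set u := iterate _ _ _ _ _ _ _ _ _ _ _.
have uS k : u k.+1 = Update W (JJ (odd k.+1)) (u k) by [].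
have u0 k : nneg (u k).
  by elim: k => // k IHk; rewrite uS; apply: update_nneg.
have up0 b p : nneg p -> nneg (Update W0 (JJ b) p).
  by move=> p0; apply: update_nneg.
have uE k : E (u k.+1) <= E (Update W0 (JJ (odd k.+1)) (u k)).
  have := W_le_W0 _ _ (u0 k) (hJJ (odd k.+1)); rewrite -uS.
  by rewrite !scoreE// ?lee_fin//; exact: up0.
have W0E b p : nneg p -> E (Update W0 (JJ b) p) <= E p.
  move=> p0; rewrite -lee_fin -!scoreE//; last exact: up0.
  exact: update_score_le.
have uanti k : E (u k.+1) <= E (u k) by apply: le_trans (uE k) (W0E _ _ (u0 k)).
have [C EC] := energy_coercive reg.
apply: (@descent_cvg R _ nneg (box [set: X * Y]%SET (E pinit + C)) E
  (fun b => Update W0 (JJ b)) (fun k => odd k.+1)) => //.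
- exact: compact_box.
- exact: box_Mplus.
- move=> k; apply: Mplus_box => // z; apply: le_trans (EC _ z (u0 k)) _.
  rewrite lerD2r; elim: k => // k; exact: le_trans (uanti k).
- move=> q q0; apply: (energy_cvg reg) => //; first exact: withinT.
  move=> z; apply: cvg_within_filter; exact: (@proj_continuous _ (fun=> R) z q).
- move=> b q q0; exact: update_cvg.
- move=> b q q0 qopt; rewrite -lte_fin -!scoreE//; last exact: up0.
  apply: (W0_admissible.2 _ _ q0 (hJJ b)) => qfix; apply: qopt.
  apply: (popt_min q q0).2.
  exact: (block_fixpoint_optimal (hJJ b) q0 qfix).
Qed.

End DomainDecomposition.

Local Open Scope ereal_scope.

Theorem proposition3p12 (R : realType) (X Y I : finType)
  (mu : meas R X) (nu : meas R Y) (c : X * Y -> R) (eps : R)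
  (phi1 phi2 : R -> \bar R) (Xc : I -> {set X}) (JA JB : {set {set I}})
  (pinit : meas R (X * Y)%type) (W0 W : weights R X Y I)
  (hmu : full_support mu) (hnu : full_support nu) (heps : (0 < eps)%R)
  (hphi1 : entropy_function phi1) (hphi2 : entropy_function phi2)
  (phi1_ge0 : forall x, 0 <= phi1 x) (phi2_ge0 : forall x, 0 <= phi2 x)
  (phi1_fin : forall x, (0 <= x)%R -> phi1 x < +oo)
  (phi2_fin : forall x, (0 <= x)%R -> phi2 x < +oo)
  (phi1_C1 : C1_on_interior_dom phi1) (phi2_C1 : C1_on_interior_dom phi2)
  (hXc : basic_partition mu Xc)
  (hJA : composite_partition JA) (hJB : composite_partition JB)
  (hpinit : Mplus [set: X * Y]%SET pinit)
  (pinit_feasible : score c eps mu nu phi1 phi2 pinit < +oo)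
  (hW0 : weight_function Xc W0)
  (W0_admissible : admissible c eps mu nu phi1 phi2 Xc W0)
  (hW : weight_function Xc W)
  (W_le_W0 : forall (p : meas R (X * Y)%type) (JJ : {set {set I}}),
     Mplus [set: X * Y]%SET p -> composite_partition JJ ->
     score c eps mu nu phi1 phi2 (update c eps mu nu phi1 phi2 Xc W JJ p)
     <= score c eps mu nu phi1 phi2 (update c eps mu nu phi1 phi2 Xc W0 JJ p)) :
  exists2 popt : meas R (X * Y)%type,
    argmin (Mplus [set: X * Y]%SET) (score c eps mu nu phi1 phi2) = [set popt] &
    iterate c eps mu nu phi1 phi2 Xc W JA JB pinit @ \oo --> popt.
Proof.
exact: (iterate_cvg_minimizer hmu hnu heps hphi1 hphi2 phi1_ge0 phi2_ge0
  phi1_fin phi2_fin phi1_C1 phi2_C1 hXc hJA hJB hpinit hW0 W0_admissible hW).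
Qed.
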